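(* Let $G$ be a simply connected complex almost Abelian Lie group. Then every discrete subgroup $D \subseteq G$ is finitely generated.
   Context: All Lie groups and Lie algebras are finite-dimensional and complex. An almost Abelian Lie algebra is a non-Abelian Lie algebra having an Abelian subalgebra of codimension 1; a (connected) almost Abelian Lie group is a connected complex Lie group whose Lie algebra is almost Abelian. Every such Lie algebra is isomorphic to $\mathbb{C}^d \oplus \mathbb{C}$ with bracket $[(v,t),(u,s)] = (tJu - sJv, 0)$ for some nonzero $d\times d$ complex matrix $J$ in Jordan normal form. The corresponding simply connected group is $\mathbb{C}^d \rtimes \mathbb{C}$, with elements $[v,t]$ ($v\in\mathbb{C}^d$, $t\in\mathbb{C}$) and product $[v,t][u,s] = [v+e^{tJ}u,\, t+s]$. *)

(* Defs.v *)
From HB Require Import structures.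
From mathcomp Require Import all_boot all_order all_algebra complex.
From mathcomp Require Import all_classical all_reals topology normedtype.
From mathcomp Require Import sequences exp.
Set Implicit Arguments.
Unset Strict Implicit.
Unset Printing Implicit Defensive.
Import Order.TTheory GRing.Theory Num.Theory numFieldNormedType.Exports.
Local Open Scope classical_set_scope.
Local Open Scope ring_scope.

(* The type ascription makes the norm topology of numFieldNormedType visible
   on R[i] and on matrices over it. *)
Definition cplx (R : realType) : numClosedFieldType := R[i]%C.

Definition expmx (R : realType) d (A : 'M[cplx R]_d) : 'M[cplx R]_d :=
  limn (series (fun k => (k`!%:R)^-1 *: A ^+ k)).

Definition jordan_block (K : pzRingType) n (a : K) : 'M[K]_n :=
  \matrix_(i, j) (a *+ (i == j) + (i.+1 == j :> nat)%:R).

Definition jordan_normal_form (K : pzRingType) d (J : 'M[K]_d) : Prop :=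
  exists (k : nat) (n : 'I_k -> nat) (a : 'I_k -> K)
         (e : (\sum_i n i)%N = d),
    (forall i, (0 < n i)%N) /\
    J = castmx (e, e) (\mxdiag_i jordan_block (n i) (a i)).

(* E n is the n-th partial sum of the exponential series; c k stands for 1/k!,
   embedded centrally, so that this applies to matrices and to reals alike. *)
Section Truncated.
Variables (A : pzRingType) (c : nat -> A).
Hypothesis c_comm : forall k x, GRing.comm (c k) x.
Hypothesis c_fact : forall k, c k * k`!%:R = 1.

Let E n x := \sum_(0 <= k < n) c k * x ^+ k.

Lemma triangular_sum (f : nat -> nat -> A) n :
  \sum_(0 <= k < n) \sum_(i < k.+1) f i (k - i)%N =
  \sum_(0 <= i < n) \sum_(0 <= j < n | (i + j < n)%N) f i j.
Proof.
transitivity (\sum_(0 <= k < n) \sum_(0 <= i < n | (i <= k)%N) f i (k - i)%N).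
  apply: eq_big_nat => k /andP[_ kn].
  by rewrite -(big_mkord xpredT (fun i => f i (k - i)%N)) (big_nat_widen _ _ n).
rewrite (exchange_big_dep_nat xpredT)//=.
apply: eq_big_nat => i /andP[_ ilt].
transitivity (\sum_(i <= k < n) f i (k - i)%N).
  by rewrite (big_nat_widenl i 0).
rewrite -{1}(add0n i) big_addn (big_nat_widen 0 (n - i) n) ?leq_subr//.
by apply: eq_big => [j|j _]; rewrite ?addnK// ltn_subRL.
Qed.

Lemma trunc_coef k i : (i <= k)%N -> c k * 'C(k, i)%:R = c i * c (k - i)%N.
Proof.
move=> ik; pose u : A := (i`! * (k - i)`!)%:R.
have h1 : c k * 'C(k, i)%:R * u = 1.
  by rewrite -mulrA /u -natrM bin_fact// c_fact.
have h2 : c i * c (k - i)%N * u = 1.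
  rewrite /u natrM -mulrA (mulrA (c (k - i)%N)) (c_comm _ i`!%:R).
  by rewrite -mulrA c_fact mulr1 c_fact.
have h3 : u * (c i * c (k - i)%N) = 1.
  by rewrite -h2; apply/esym/commr_nat.
rewrite -[LHS]mulr1.
transitivity (c k * 'C(k, i)%:R * (u * (c i * c (k - i)%N))).
  by rewrite h3.
by rewrite mulrA h1 mul1r.
Qed.

Lemma trunc_binom k x y : GRing.comm x y ->
  c k * (x + y) ^+ k =
  \sum_(i < k.+1) (c i * x ^+ i) * (c (k - i)%N * y ^+ (k - i)%N).
Proof.
move=> xy; rewrite addrC exprDn_comm; last exact: commr_sym.
rewrite mulr_sumr; apply: eq_bigr => i _.
rewrite -mulr_natl mulrA (trunc_coef (ltn_ord i : (i <= k)%N)).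
rewrite -!mulrA; congr (_ * _).
have -> : y ^+ (k - i) * x ^+ i = x ^+ i * y ^+ (k - i).
  by apply: commrX; apply/commr_sym/commrX.
by rewrite !mulrA; congr (_ * _); exact: c_comm.
Qed.

Lemma truncM_sub n x y : GRing.comm x y ->
  E n x * E n y - E n (x + y) =
  \sum_(0 <= i < n) \sum_(0 <= j < n | (n <= i + j)%N)
     (c i * x ^+ i) * (c j * y ^+ j).
Proof.
move=> xy; rewrite /E.
under [X in _ - X]eq_bigr do rewrite trunc_binom//.
rewrite (triangular_sum (fun i j => (c i * x ^+ i) * (c j * y ^+ j))).
rewrite big_distrl/= -sumrB; apply: eq_bigr => i _.
rewrite big_distrr/= (bigID (fun j => (i + j < n)%N))/= addrC addrK.
by apply: eq_bigl => j; rewrite -leqNgt.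
Qed.
End Truncated.

Import ComplexField.Normc.
Section NormC.
Variable R : realType.
Implicit Types z w : R[i]%C.

Lemma normc_ge0 z : 0 <= normc z.
Proof. by case: z => a b /=; exact: sqrtr_ge0. Qed.

Lemma normc_le_ReIm z : normc z <= `|complex.Re z| + `|complex.Im z|.
Proof.
case: z => a b /=; rewrite -[leRHS]ger0_norm ?addr_ge0// -sqrtr_sqr.
rewrite ler_wsqrtr// sqrrD !real_normK ?num_real// -addrA lerD2l addrC lerDl.
by rewrite mulrn_wge0// mulr_ge0.
Qed.

Lemma Re_le_normc z : `|complex.Re z| <= normc z.
Proof.
case: z => a b /=; rewrite -sqrtr_sqr ler_wsqrtr// lerDl; exact: sqr_ge0.
Qed.

Lemma Im_le_normc z : `|complex.Im z| <= normc z.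
Proof.
case: z => a b /=; rewrite -sqrtr_sqr ler_wsqrtr// lerDr; exact: sqr_ge0.
Qed.

Lemma cvg_cplx (u : nat -> cplx R) (l : cplx R) :
  (normc (u n - l)) @[n --> \oo] --> (0 : R) -> u n @[n --> \oo] --> l.
Proof.
move=> ul; apply/cvgrPdist_lt => e e0.
have [eI eR] : complex.Im e = 0 /\ 0 < complex.Re e.
  by move: e0; rewrite ltcE/= => /andP[/eqP].
near=> n.
have : normc (u n - l) < complex.Re e.
  near: n; move/cvgrPdist_lt : ul => /(_ _ eR); apply: filterS => n.
  by rewrite sub0r normrN ger0_norm ?normc_ge0.
rewrite distrC => h; rewrite ltcE/=; rewrite eI eqxx/=.
exact: h.
Unshelve. all: by end_near. Qed.

Lemma cvg_mx d (F : nat -> 'M[cplx R]_d) (L : 'M[cplx R]_d) :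
  (forall i j, F n i j @[n --> \oo] --> L i j) -> F n @[n --> \oo] --> L.
Proof.
move=> FL; apply/cvg_ballP => e e0; near=> n.
split => //; near: n; apply: filter_forall => i; apply: filter_forall => j.
exact: (cvg_ball (FL i j)).
Unshelve. all: by end_near. Qed.

Lemma cvg_mxE d (F : nat -> 'M[cplx R]_d) (L : 'M[cplx R]_d) i j :
  F n @[n --> \oo] --> L -> F n i j @[n --> \oo] --> L i j.
Proof. move=> FL; exact: (continuous_cvg _ (@coord_continuous _ _ _ i j _) FL). Qed.

End NormC.

Section ExpMx.
Variables (R : realType) (d : nat).
Implicit Types x y : 'M[cplx R]_d.

(* Entrywise l1 norm, taken with values in R rather than in cplx R. *)
Let N x : R := \sum_i \sum_j normc (x i j).

Let N_ge0 x : 0 <= N x.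
Proof. by do 2! (apply: sumr_ge0 => ? _); exact: normc_ge0. Qed.

Let entry_le x i j : normc (x i j) <= N x.
Proof.
rewrite /N (bigD1 i)//= (bigD1 j)//= -addrA lerDl addr_ge0//.
  by apply: sumr_ge0 => ? _; exact: normc_ge0.
by do 2! (apply: sumr_ge0 => ? _); exact: normc_ge0.
Qed.

Let ND x y : N (x + y) <= N x + N y.
Proof.
rewrite /N -big_split; apply: ler_sum => i _; rewrite -big_split/=.
by apply: ler_sum => j _; rewrite mxE; exact: le_normcD.
Qed.

Let N0 : N 0 = 0.
Proof. by rewrite /N big1// => i _; rewrite big1// => j _; rewrite mxE; exact: normc0. Qed.

Let N_sum I (r : seq I) P (F : I -> 'M[cplx R]_d) :
  N (\sum_(i <- r | P i) F i) <= \sum_(i <- r | P i) N (F i).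
Proof.
elim/big_ind2 : _ => [|x a y b xa yb|//]; first by rewrite N0.
exact: (le_trans (ND _ _) (lerD xa yb)).
Qed.

Let NM x y : N (x *m y) <= N x * N y.
Proof.
have h i j : normc ((x *m y) i j) <= \sum_k normc (x i k) * normc (y k j).
  rewrite mxE; elim/big_ind2 : _ => [|a b a' b' h h'|k _].
  - by rewrite [X in X <= _]normc0.
  - exact: (le_trans (le_normcD _ _) (lerD h h')).
  - by rewrite [X in X <= _]normcM.
apply: (@le_trans _ _ (\sum_i \sum_j \sum_k normc (x i k) * normc (y k j))).
  by apply: ler_sum => i _; apply: ler_sum => j _; exact: h.
rewrite /N big_distrl/=; apply: ler_sum => i _.
rewrite exchange_big big_distrl/=; apply: ler_sum => k _.
rewrite -mulr_sumr ler_wpM2l ?normc_ge0//.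
rewrite [leRHS](bigD1 k)//= lerDl.
by do 2! (apply: sumr_ge0 => ? _); exact: normc_ge0.
Qed.

Let NX x k : N (x ^+ k) <= N 1 * N x ^+ k.
Proof.
elim: k => [|k ih]; first by rewrite !expr0 mulr1.
rewrite !exprSr mulrA; apply: (le_trans (NM _ _)).
by rewrite ler_wpM2r.
Qed.

Let ef k : 'M[cplx R]_d := (k`!%:R^-1)%:M.

Let Nterm x k : N (ef k * x ^+ k) <= N 1 * exp_coeff (N x) k.
Proof.
have -> : N (ef k * x ^+ k) = k`!%:R^-1 * N (x ^+ k).
  rewrite /ef [_ * _]mul_scalar_mx /N mulr_sumr; apply: eq_bigr => i _.
  rewrite mulr_sumr; apply: eq_bigr => j _; rewrite mxE [LHS]normcM.
  congr (_ * _).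
  have -> : (k`!%:R : cplx R) = ((k`!%:R : R)%:C)%C.
    by rewrite [RHS](rmorph_nat (real_complex R)).
  by rewrite [LHS]normcV /= expr0n/= addr0 sqrtr_sqr ger0_norm.
by rewrite /exp_coeff/= mulrA [leRHS]mulrC ler_wpM2l ?invr_ge0.
Qed.

Let expmx_series x := series (fun k => (k`!%:R)^-1 *: x ^+ k).

Let expmx_seriesE x n : expmx_series x n = \sum_(0 <= k < n) ef k * x ^+ k.
Proof.
by apply: eq_bigr => k _; rewrite /ef [RHS]mul_scalar_mx.
Qed.

Let is_cvg_proj (f : R[i]%C -> R) x i j :
  (forall z w, f (z + w) = f z + f w) -> f 0 = 0 ->
  (forall z, `|f z| <= normc z) ->
  cvgn (fun n => f (expmx_series x n i j)).
Proof.
move=> fD f0 fle.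
have -> : (fun n => f (expmx_series x n i j)) =
          series (fun k => f ((ef k * x ^+ k) i j)).
  apply/funext => n; rewrite expmx_seriesE summxE.
  exact: (big_morph f fD f0).
apply: normed_cvg; apply: (@series_le_cvg _ _ (N 1 *: exp_coeff (N x))).
- by move=> n /=.
- by move=> n; rewrite mulr_ge0// exp_coeff_ge0.
- move=> n /=; apply: (le_trans (fle _)); apply: (le_trans (entry_le _ _ _)).
  exact: Nterm.
- exact/is_cvg_seriesZ/is_cvg_series_exp_coeff.
Qed.

Lemma cvg_expmx x :
  series (fun k => (k`!%:R)^-1 *: x ^+ k) @ \oo --> expmx x.
Proof.
rewrite -/(expmx_series x).
pose re i j n := complex.Re (expmx_series x n i j : R[i]%C).
pose im i j n := complex.Im (expmx_series x n i j : R[i]%C).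
have cre i j : cvgn (re i j).
  apply: is_cvg_proj => //; last exact: Re_le_normc.
  by move=> [? ?] [? ?].
have cim i j : cvgn (im i j).
  apply: is_cvg_proj => //; last exact: Im_le_normc.
  by move=> [? ?] [? ?].
apply: (@cvgP _ _ (\matrix_(i, j) (limn (re i j) +i* limn (im i j))%C : 'M[cplx R]_d)).
apply: cvg_mx => i j; rewrite mxE; apply: cvg_cplx.
apply: (@squeeze_cvgr _ _ _ _ (fun=> 0) 
   (fun n => `|re i j n - limn (re i j)| + `|im i j n - limn (im i j)|)).
- near=> n; rewrite normc_ge0/=; apply: (le_trans (normc_le_ReIm _)).
  by rewrite /re /im; case: (expmx_series x n i j).
- exact: cvg_cst.
- rewrite -[X in _ --> X](addr0 (0 : R)); apply: cvgD; rewrite -[X in _ --> X](@normr0 R R);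
  by apply: cvg_norm; apply/subr_cvg0.
Unshelve. all: by end_near. Qed.

Let efM x y i j :
  N ((ef i * x ^+ i) * (ef j * y ^+ j)) <=
  N 1 ^+ 2 * (exp_coeff (N x) i * exp_coeff (N y) j).
Proof.
apply: (le_trans (NM _ _)); rewrite expr2 mulrACA.
by apply: ler_pM => //; exact: Nterm.
Qed.

Let real_ef (k : nat) : R := k`!%:R^-1.

Lemma expmxD x y : GRing.comm x y -> expmx (x + y) = expmx x *m expmx y.
Proof.
move=> xy.
pose F n := expmx_series x n *m expmx_series y n - expmx_series (x + y) n.
have ef_comm k (z : 'M[cplx R]_d) : GRing.comm (ef k) z.
  exact: comm_scalar_mx.
have ef_fact k : ef k * k`!%:R = 1.
  rewrite /ef -(rmorph_nat (@scalar_mx _ d)) -rmorphM mulVf//.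
  by rewrite pnatr_eq0 -lt0n fact_gt0.
have rf_comm k (z : R) : GRing.comm (real_ef k) z by exact: mulrC.
have rf_fact k : real_ef k * k`!%:R = 1.
  by rewrite mulVf// pnatr_eq0 -lt0n fact_gt0.
pose D n := series (exp_coeff (N x)) n * series (exp_coeff (N y)) n
            - series (exp_coeff (N x + N y)) n.
have seriesE (a : R) n : series (exp_coeff a) n = \sum_(0 <= k < n) real_ef k * a ^+ k.
  by apply: eq_bigr => k _; rewrite /exp_coeff/= mulrC.
have FD n : N (F n) <= N 1 ^+ 2 * D n.
  rewrite /F /D !seriesE !expmx_seriesE.
  rewrite (truncM_sub rf_comm rf_fact n (mulrC _ _)).
  rewrite [X in N X](truncM_sub ef_comm ef_fact n xy).
  apply: (le_trans (N_sum _ _ _)); rewrite mulr_sumr; apply: ler_sum => i _.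
  apply: (le_trans (N_sum _ _ _)); rewrite mulr_sumr; apply: ler_sum => j _.
  by rewrite !(mulrC (real_ef _)); exact: efM.
have D0 : D n @[n --> \oo] --> (0 : R).
  have <- : expR (N x) * expR (N y) - expR (N x + N y) = 0.
    by rewrite expRD subrr.
  apply: cvgB; last exact: is_cvg_series_exp_coeff.
  by apply: cvgM; exact: is_cvg_series_exp_coeff.
have F0 i j : F n i j @[n --> \oo] --> (0 : cplx R).
  apply: cvg_cplx.
  apply: (@squeeze_cvgr _ _ _ _ (fun=> 0) (fun n => N 1 ^+ 2 * D n)).
  - near=> n; rewrite normc_ge0/= subr0; apply: le_trans (FD n); exact: entry_le.
  - exact: cvg_cst.
  - by rewrite -[X in _ --> X](mulr0 (N 1 ^+ 2)); apply: cvgMr.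
apply/esym/eqP; rewrite -subr_eq0; apply/eqP/matrixP => i j; rewrite [RHS]mxE.
have H : F n i j @[n --> \oo] -->
    (\sum_k expmx x i k * expmx y k j - expmx (x + y) i j : cplx R).
  have -> : (fun n => F n i j) = (fun n => \sum_k expmx_series x n i k *
     expmx_series y n k j - expmx_series (x + y) n i j).
    by apply/funext => n; rewrite !mxE.
  apply: cvgB; last by apply: cvg_mxE; exact: cvg_expmx.
  apply: cvg_big => [|k _]; first exact: add_continuous.
  by apply: cvgM; apply: cvg_mxE; exact: cvg_expmx.
rewrite 3!mxE -(cvg_lim (@norm_hausdorff _ (cplx R)) H).
exact: (cvg_lim (@norm_hausdorff _ (cplx R)) (F0 i j)).
Unshelve. all: by end_near. Qed.

Lemma expmx0 : expmx 0 = 1%:M :> 'M[cplx R]_d.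
Proof.
apply/cvg_lim; first exact: norm_hausdorff.
apply: cvg_near_cst; exists 1%N => // -[//|n] _ /=.
rewrite /series/= big_nat_recl// expr0 fact0 invr1 scale1r.
by rewrite big1 ?addr0// => k _; rewrite expr0n scaler0.
Qed.

End ExpMx.

(* The simply connected group attached to J, in its complex coordinates [v,t].
   The type depends on J only so that the group law below can be inferred
   from it. *)
Definition almost_abelian_group (R : realType) d (J : 'M[cplx R]_d) : Type :=
  ('cV[cplx R]_d * cplx R)%type.

Section AlmostAbelianGroup.
Variables (R : realType) (d : nat) (J : 'M[cplx R]_d).

Local Notation G := (almost_abelian_group J).

HB.instance Definition _ := Choice.copy G ('cV[cplx R]_d * cplx R)%type.
HB.instance Definition _ := Topological.copy G ('cV[cplx R]_d * cplx R)%type.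

Implicit Types p q : G.

Definition aag_mul p q : G := (p.1 + expmx (p.2 *: J) *m q.1, p.2 + q.2).
Definition aag_one : G := (0, 0).
Definition aag_inv p : G := (- (expmx (- p.2 *: J) *m p.1), - p.2).

Lemma expmxDJ s t : expmx ((s + t) *: J) = expmx (s *: J) *m expmx (t *: J).
Proof.
rewrite scalerDl expmxD//.
by rewrite /GRing.comm; rewrite -[LHS]scalemxAl -[RHS]scalemxAl -!scalemxAr !scalerA mulrC.
Qed.

Lemma aag_mulA : associative aag_mul.
Proof.
move=> p q r; rewrite /aag_mul/= addrA expmxDJ; congr (_, _).
by rewrite mulmxDr addrA mulmxA.
Qed.

Lemma aag_mul1 : left_id aag_one aag_mul.
Proof.
by case=> v t; rewrite /aag_mul/= !add0r scale0r expmx0 mul1mx.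
Qed.

Lemma aag_mulV : left_inverse aag_one aag_inv aag_mul.
Proof. by move=> p; rewrite /aag_mul/= !addNr. Qed.

Lemma aag_mulr1 : right_id aag_one aag_mul.
Proof. by case=> v t; rewrite /aag_mul/= mulmx0 !addr0. Qed.

Lemma aag_mulrV : right_inverse aag_one aag_inv aag_mul.
Proof.
move=> p; rewrite /aag_mul/= mulmxN mulmxA -expmxDJ subrr scale0r expmx0.
by rewrite mul1mx subrr.
Qed.

HB.instance Definition _ := isGroup.Build G
  aag_mulA aag_mul1 aag_mulr1 aag_mulV aag_mulrV.

End AlmostAbelianGroup.

Definition generated_subgroup (G : groupType) (S : set G) : set G :=
  smallest (fun H : set G => group_closed [in H]) S.

Definition finitely_generated (G : groupType) (D : set G) : Prop :=
  exists2 S : set G, finite_set S & D = generated_subgroup S.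

Definition discrete_subset (T : topologicalType) (D : set T) : Prop :=
  D `<=` isolated D.

(* Main.v *)
(* For g in D let x(g) and tau(g) be the real coordinates of its vector and time
   parts, and let rho(g) be the real matrix of e^{tJ}.  Discreteness means that
   subsets of D on which x and tau are bounded are finite.

   The elements with tau = 0 form a discrete subgroup L of a real vector space,
   so L is finitely generated.  Modulo the real span W of L the group D becomes
   commutative, and x mod W is a cocycle for commuting matrices; the image is
   still discrete because L is cocompact in W.  On a Fitting component where
   some rho(s) - 1 is invertible the cocycle is a coboundary, hence bounded in
   terms of tau, and can be discarded.  On the remaining part all rho(g) are
   unipotent, and the logarithm turns the cocycle into a homomorphism ell to a
   real vector space.  Then (ell, tau) is a homomorphism whose bounded fibres
   are finite modulo L, and D is finitely generated over L as a lattice is. *)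

Require Import Defs.
From HB Require Import structures.
From mathcomp Require Import all_boot all_order all_algebra complex.
From mathcomp Require Import all_classical all_reals topology normedtype.
From mathcomp Require Import sequences exp lra.

Set Implicit Arguments.
Unset Strict Implicit.
Unset Printing Implicit Defensive.
Import Order.TTheory GRing.Theory Num.Theory numFieldNormedType.Exports.
Import ComplexField.Normc.
Local Open Scope classical_set_scope.
Local Open Scope ring_scope.

(** * Finite generation from homomorphisms to real vector spaces *)

Lemma mxBE (V : zmodType) p q (M N : 'M[V]_(p, q)) i j :
  (M - N) i j = M i j - N i j.
Proof. by rewrite !mxE. Qed.

(** * Entrywise boundedness of matrix-valued functions *)

Section EntrywiseBounds.
Variables (R : realType) (T : Type).
Implicit Types A : set T.

Definition ebounded p q A (f : T -> 'M[R]_(p, q)) :=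
  exists r, forall a, A a -> forall i j, `|f a i j| <= r.

Lemma ebounded_eq p q A (f g : T -> 'M[R]_(p, q)) :
  (forall a, A a -> f a = g a) -> ebounded A f -> ebounded A g.
Proof. by move=> fg [r fr]; exists r => a Aa i j; rewrite -fg ?fr. Qed.

Lemma ebounded_cst p q A (M : 'M[R]_(p, q)) : ebounded A (fun=> M).
Proof.
exists (\sum_i \sum_j `|M i j|) => a _ i j.
rewrite (bigD1 i)//= (bigD1 j)//= -addrA lerDl addr_ge0//.
  by apply: sumr_ge0.
by do 2! (apply: sumr_ge0 => ? _).
Qed.

Lemma eboundedD p q A (f g : T -> 'M[R]_(p, q)) :
  ebounded A f -> ebounded A g -> ebounded A (fun a => f a + g a).
Proof.
move=> [r fr] [s gs]; exists (r + s) => a Aa i j; rewrite mxE.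
by apply: le_trans (ler_normD _ _) _; rewrite lerD ?fr ?gs.
Qed.

Lemma eboundedM p q s A (f : T -> 'M[R]_(p, q)) (g : T -> 'M[R]_(q, s)) :
  ebounded A f -> ebounded A g -> ebounded A (fun a => f a *m g a).
Proof.
move=> [u fu] [v gv]; exists (\sum_(k < q) u * v) => a Aa i j; rewrite mxE.
apply: le_trans (ler_norm_sum _ _ _) _; apply: ler_sum => k _.
by rewrite normrM ler_pM ?fu ?gv.
Qed.

Lemma eboundedZ p q A c (f : T -> 'M[R]_(p, q)) :
  ebounded A f -> ebounded A (fun a => c *: f a).
Proof.
move=> [r fr]; exists (`|c| * r) => a Aa i j.
by rewrite mxE normrM ler_wpM2l ?fr.
Qed.

Lemma eboundedB p q A (f g : T -> 'M[R]_(p, q)) :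
  ebounded A f -> ebounded A g -> ebounded A (fun a => f a - g a).
Proof.
move=> Af Ag; apply: (@ebounded_eq _ _ _ (fun a => f a + (-1) *: g a)).
  by move=> a _; rewrite scaleN1r.
exact/eboundedD/eboundedZ.
Qed.

Lemma ebounded_sum p q A n (f : 'I_n -> T -> 'M[R]_(p, q)) :
  (forall i, ebounded A (f i)) -> ebounded A (fun a => \sum_i f i a).
Proof.
move=> /choice[r fr]; exists (\sum_i r i) => a Aa i j; rewrite summxE.
by apply: le_trans (ler_norm_sum _ _ _) _; apply: ler_sum => k _; rewrite fr.
Qed.

Lemma eboundedX p A n (f : T -> 'M[R]_p) :
  ebounded A f -> ebounded A (fun a => f a ^+ n).
Proof.
move=> Af; elim: n => [|n IH].
  by apply: ebounded_eq (ebounded_cst A 1%:M) => a _; rewrite expr0.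
apply: ebounded_eq (eboundedM Af IH) => a _; by rewrite exprS.
Qed.

Lemma ebounded_lsub p q s A (f : T -> 'M[R]_(p, q)) (g : T -> 'M[R]_(p, s)) :
  ebounded A (fun a => row_mx (f a) (g a)) -> ebounded A f.
Proof.
move=> [r h]; exists r => a Aa i j.
by have := h a Aa i (lshift _ j); rewrite row_mxEl.
Qed.

Lemma ebounded_rsub p q s A (f : T -> 'M[R]_(p, q)) (g : T -> 'M[R]_(p, s)) :
  ebounded A (fun a => row_mx (f a) (g a)) -> ebounded A g.
Proof.
move=> [r h]; exists r => a Aa i j.
by have := h a Aa i (rshift _ j); rewrite row_mxEr.
Qed.

End EntrywiseBounds.

(** * Subgroups and additive maps to real row spaces *)

Section FiniteGeneration.
Variables (R : realType) (G : groupType).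
Implicit Types (A D H L S : set G) (g h : G).

Lemma subgroup1 D : group_closed [in D] -> D 1%g.
Proof. by move=> [/set_mem]. Qed.

Lemma subgroupV D g : group_closed [in D] -> D g -> D g^-1%g.
Proof. by move=> /group_closedV DV Dg; apply/set_mem/DV/mem_set. Qed.

Lemma subgroupM D g h : group_closed [in D] -> D g -> D h -> D (g * h)%g.
Proof.
by move=> /group_closedM DM Dg Dh; apply/set_mem/DM; apply/mem_set.
Qed.

Lemma subgroupX D g n : group_closed [in D] -> D g -> D (g ^+ n)%g.
Proof.
move=> Dg gD; elim: n => [|n IH]; first by rewrite expg0; exact: subgroup1.
by rewrite expgS; exact: subgroupM.
Qed.

Lemma subgroupP D :
  D 1%g -> (forall g h, D g -> D h -> D (g * h^-1)%g) -> group_closed [in D].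
Proof.
move=> D1 DB; split; first exact/mem_set.
by move=> g h /set_mem Dg /set_mem Dh; apply/mem_set/DB.
Qed.

Lemma finitely_generatedP D S :
    group_closed [in D] -> finite_set S -> S `<=` D ->
    (forall H, group_closed [in H] -> S `<=` H -> D `<=` H) ->
  finitely_generated D.
Proof.
move=> Dg Sfin SD DS; exists S => //; apply/seteqP; split.
  by move=> g Dg' H [Hg SH]; exact: DS Hg SH _ Dg'.
by move=> g; apply.
Qed.

Lemma finitely_generated_min D :
  finitely_generated D ->
  exists S, [/\ finite_set S, S `<=` D &
    forall H, group_closed [in H] -> S `<=` H -> D `<=` H].
Proof.
move=> [S Sfin ->]; exists S; split => //.
  by move=> g Sg H [_]; exact.
by move=> H Hg SH g; apply.
Qed.

(** Finitely many right cosets of [L] cover [A]; the representatives may lie outside [A]. *)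
Definition finite_mod L A :=
  exists2 F : set G, finite_set F &
    A `<=` [set g | exists2 f, F f & L (g * f^-1)%g].

(* Writes a real combination of the images [phi (b i)] as the image of an
   element of the group generated by the [b i] plus a combination with
   coefficients in [0, 1[. *)
Lemma integral_part D n (phi : G -> 'rV[R]_n) m (b : 'I_m -> G) (a : 'I_m -> R) :
    group_closed [in D] ->
    (forall g h, D g -> D h -> phi (g * h)%g = phi g + phi h) ->
    (forall i, D (b i)) ->
  exists g, [/\ D g, (forall H, group_closed [in H] -> (forall i, H (b i)) -> H g) &
    exists c : 'I_m -> R, (forall i, `|c i| <= 1) /\
      \sum_i a i *: phi (b i) = phi g + \sum_i c i *: phi (b i)].
Proof.
move=> Dg phiM Db.
have phi1 : phi 1%g = 0.
  have := phiM _ _ (subgroup1 Dg) (subgroup1 Dg).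
  by rewrite mulg1 => /(congr1 (fun z => z - phi 1%g)); rewrite subrr addrK.
have phiV g : D g -> phi (g^-1)%g = - phi g.
  move=> gD; have := phiM _ _ (subgroupV Dg gD) gD.
  by rewrite mulVg phi1 => /esym/eqP; rewrite addr_eq0 => /eqP.
have phiX g k : D g -> phi (g ^+ k)%g = k%:R *: phi g.
  move=> gD; elim: k => [|k IH]; first by rewrite expg0 scale0r.
  rewrite expgS phiM ?IH//; last exact: subgroupX.
  by rewrite -natr1 scalerDl scale1r addrC.
have powz g (z : int) : D g -> exists h,
    [/\ D h, (forall H, group_closed [in H] -> H g -> H h) &
    phi h = z%:~R *: phi g].
  move=> gD; case: z => k.
    exists (g ^+ k)%g; split; [exact: subgroupX| |by rewrite phiX].
    by move=> H Hg gH; exact: subgroupX.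
  exists (g ^+ k.+1)^-1%g; split.
  - by apply: subgroupV => //; exact: subgroupX.
  - by move=> H Hg gH; apply: subgroupV => //; exact: subgroupX.
  - by rewrite phiV ?phiX ?NegzE ?mulrNz ?scaleNr//; exact: subgroupX.
pose c i := a i - (Num.floor (a i))%:~R.
suff [g [gD gH pg]] : exists g, [/\ D g,
    (forall H, group_closed [in H] -> (forall i, H (b i)) -> H g) &
    phi g = \sum_i (Num.floor (a i))%:~R *: phi (b i)].
  exists g; split => //; exists c; split.
    move=> i; rewrite /c ger0_norm ?subr_ge0 ?floor_le_tmp//.
    by rewrite lerBlDl -[1%R]/(1%:~R) -intrD ltW// floorD1_gt.
  rewrite pg -big_split/=; apply: eq_bigr => i _.
  by rewrite -scalerDl /c addrC subrK.
elim: (index_enum _) => [|i s [g [gD gH pg]]].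
  exists 1%g; split; [exact: subgroup1| |by rewrite big_nil].
  by move=> H Hg _; exact: subgroup1.
have [h [hD hH ph]] := powz (b i) (Num.floor (a i)) (Db i).
exists (h * g)%g; split; first exact: subgroupM.
- by move=> H Hg Hb; apply: subgroupM => //; [exact: hH|exact: gH].
- by rewrite big_cons phiM// ph pg.
Qed.

(** A family of maximal rank works: prepending an element whose image leaves the row space would
    raise the rank. *)
Lemma exists_spanning_family D n (phi : G -> 'rV[R]_n) :
  exists m (b : 'I_m -> G), (forall i, D (b i)) /\
    forall g, D g -> (phi g <= \matrix_i phi (b i))%MS.
Proof.
pose P r := `[< exists m (b : 'I_m -> G),
  (forall i, D (b i)) /\ \rank (\matrix_i phi (b i)) = r >].
have exP : exists r, P r.
  exists 0%N; apply/asboolP; exists 0%N, (fun=> 1%g); split=> [[]//|].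
  by apply/eqP; rewrite -leqn0 rank_leq_row.
have Pn r : P r -> (r <= n)%N.
  by move=> /asboolP[m [b [_ <-]]]; exact: rank_leq_col.
case: (ex_maxnP exP Pn) => r /asboolP[m [b [Db br]]] rmax.
exists m, b; split => // g Dg; apply: contraT => gb.
pose b' (i : 'I_(1 + m)) := match fintype.split i with inl _ => g | inr j => b j end.
have b'E : \matrix_i phi (b' i) = col_mx (phi g) (\matrix_i phi (b i)).
  apply/row_matrixP => i; rewrite rowK /b'.
  case: (fintype.splitP i) => j ij.
    have -> : i = lshift m j by exact: val_inj.
    by rewrite rowKu row_id.
  have -> : i = rshift 1 j by exact: val_inj.
  by rewrite rowKd rowK.
have : P (\rank (\matrix_i phi (b' i))).
  apply/asboolP; exists (1 + m)%N, b'; split => // i.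
  by rewrite /b'; case: fintype.split.
move=> /rmax; rewrite leqNgt -br b'E rank_ltmx// ltmxE -addsmxE addsmxSr/=.
by apply: contra gb; rewrite -addsmxE; apply: submx_trans; exact: addsmxSl.
Qed.

(** The lattice argument: multiplying by a product of the [b i] and their inverses moves any image
    into a bounded box, and the elements of [D] lying over that box are finite modulo [L]. *)
Lemma finitely_generated_hom D L n (phi : G -> 'rV[R]_n) :
    group_closed [in D] -> finitely_generated L -> L `<=` D ->
    (forall g h, D g -> D h -> phi (g * h)%g = phi g + phi h) ->
    (forall A, A `<=` D -> ebounded A phi -> finite_mod L A) ->
  finitely_generated D.
Proof.
move=> Dg /finitely_generated_min[S [Sfin SL Lmin]] LD phiM phiF.
have [m [b [Db Dspan]]] := exists_spanning_family D phi.
pose A := [set g | D g /\ exists c : 'I_m -> R, (forall i, `|c i| <= 1) /\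
  phi g = \sum_i c i *: phi (b i)].
have [| |F Ffin AF] := phiF A.
- by move=> g [].
- exists (\sum_i \sum_j `|phi (b i) 0 j|) => g [_ [c [c1 ->]]] i j.
  rewrite summxE (le_trans (ler_norm_sum _ _ _))//; apply: ler_sum => k _.
  rewrite mxE normrM (bigD1 j)//= (ord1 i) -[leLHS]addr0 lerD//.
    by rewrite ler_piMl.
  by apply: sumr_ge0.
(* [F] is cut down to [D]; a representative that is actually used lies in [D] because [L] does. *)
apply: (@finitely_generatedP _ (S `|` range b `|` (F `&` D))) => //.
- rewrite !finite_setU; split; first split => //.
    exact: finite_image.
  exact: finite_setIl.
- by move=> g [[/SL/LD//|[i _ <-]//]|[]].
move=> H Hg SH g gD.
have Hb i : H (b i) by apply: SH; left; right; exists i.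
have /submxP[a ga] := Dspan _ gD.
have [y [yD yH [c [c1 cE]]]] := integral_part (a 0) Dg phiM Db.
have phiy : phi g = phi y + \sum_i c i *: phi (b i).
  rewrite -cE ga mulmx_sum_row; apply: eq_bigr => i _; by rewrite rowK.
have yg : A (y^-1 * g)%g.
  split; first by apply: subgroupM => //; exact: subgroupV.
  exists c; split => //.
  have : phi (y * (y^-1 * g))%g = phi y + phi (y^-1 * g)%g.
    by apply: phiM => //; apply: subgroupM => //; exact: subgroupV.
  by rewrite mulVKg phiy => /addrI.
have [f Ff Lf] := AF _ yg.
have LH : L `<=` H by apply: Lmin => // h Sh; apply: SH; left; left.
rewrite -(mulVKg y g); apply: subgroupM => //; first exact: yH.
rewrite -(mulgVK f (y^-1 * g)%g); apply: subgroupM => //; first exact: LH.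
apply: SH; right; split => //.
have -> : f = (((y^-1 * g) * f^-1)^-1 * (y^-1 * g))%g by rewrite invgF mulgVK.
by apply: subgroupM; [|apply: subgroupV; [|exact: LD]|apply: yg.1].
Qed.

End FiniteGeneration.

(** * Affine actions with commuting linear parts *)

Section BinomialPolynomials.
Variable K : numFieldType.

Definition binomial_poly j : {poly K} :=
  (j`!%:R^-1)%:P * \prod_(i < j) ('X - (i%:R)%:P).

Lemma horner_binomial_poly j n : (binomial_poly j).[n%:R] = 'C(n, j)%:R.
Proof.
rewrite /binomial_poly hornerM hornerC horner_prod.
under eq_bigr do rewrite hornerXsubC.
have -> : \prod_(i < j) (n%:R - i%:R) = (n ^_ j)%:R :> K.
  rewrite ffact_prod natr_prod; have [jn|nj] := leqP j n.
    by apply: eq_bigr => i _; rewrite natrB// ltnW// (leq_trans (ltn_ord i)).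
  (* For [n < j] the factor of index [n] kills both products, so the truncated subtraction at later
     indices is harmless. *)
  rewrite [LHS](bigD1 (Ordinal nj))//= subrr mul0r.
  by rewrite [RHS](bigD1 (Ordinal nj))//= subnn mul0r.
by rewrite -bin_ffact natrM mulrC mulfK// pnatr_eq0 -lt0n fact_gt0.
Qed.

Lemma binomial_poly1 : binomial_poly 1 = 'X.
Proof. by rewrite /binomial_poly big_ord1 subr0 invr1 mul1r. Qed.

(** The difference has at least as many roots as its size. This turns identities between powers of
    group elements into polynomial identities. *)
Lemma poly_eq_nat (p q : {poly K}) :
  (forall n, p.[n%:R] = q.[n%:R]) -> p = q.
Proof.
move=> pq; apply/eqP; rewrite -subr_eq0; apply/eqP.
pose s := [seq n%:R : K | n <- iota 0 (size (p - q))].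
apply: (@roots_geq_poly_eq0 _ _ s).
- by apply/allP => _ /mapP[n _ ->]; rewrite /root !hornerE pq subrr.
- rewrite map_inj_uniq ?iota_uniq// => m n /eqP; by rewrite eqr_nat => /eqP.
- by rewrite size_map size_iota.
Qed.

End BinomialPolynomials.

(** * Powers of unipotent matrices *)

Section Unipotent.
Variables (K : numFieldType) (k m : nat) (N : 'M[K]_k).
Hypothesis N_nilp : N ^+ m = 0.

(** The number of terms is independent of [n], so the entries are polynomial in [n]. *)
Lemma unipotentX n : (1 + N) ^+ n = \sum_(l < m) 'C(n, l)%:R *: N ^+ l.
Proof.
(* A vanishing term of index [m] lets both halves of Pascal's rule run over the same indices. *)
have addl (F : nat -> K) : \sum_(l < m.+1) F l *: N ^+ l = \sum_(l < m) F l *: N ^+ l.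
  by rewrite big_ord_recr/= N_nilp scaler0 addr0.
elim: n => [|n IH].
  rewrite -(addl (fun l => 'C(0, l)%:R)) big_ord_recl/= expr0 bin0 scale1r big1 ?addr0//.
  by move=> i _; rewrite bin0n scale0r.
rewrite exprSr IH mulrDr mulr1.
rewrite -(addl (fun l => 'C(n.+1, l)%:R)) -{1}(addl (fun l => 'C(n, l)%:R)).
rewrite !big_ord_recl/= !bin0 -addrA; congr (_ + _).
rewrite mulr_suml -big_split/=; apply: eq_bigr => i _.
rewrite binS natrD scalerDl; congr (_ + _).
by rewrite [in RHS]exprSr -[LHS]scalemxAl.
Qed.

(** This geometric sum is the factor by which a cocycle grows from [g] to its [n]-th power. *)
Lemma unipotent_sum n :
  \sum_(i < n) (1 + N) ^+ i = \sum_(l < m) 'C(n, l.+1)%:R *: N ^+ l.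
Proof.
elim: n => [|n IH].
  by rewrite big_ord0 big1// => i _; rewrite bin0n scale0r.
rewrite big_ord_recr/= IH unipotentX -big_split/=; apply: eq_bigr => i _.
by rewrite binS natrD scalerDl.
Qed.

End Unipotent.

(** The constant terms cancel, leaving [N] times a matrix commuting with it. *)
Lemma nilpotent_one_sub (K : numFieldType) k m (N : 'M[K]_k) (beta : nat -> K) :
  beta 0%N = 1 -> N ^+ m = 0 -> (1 - \sum_(l < m) beta l *: N ^+ l) ^+ m = 0.
Proof.
move=> b1; case: m => [|n] Nn; first exact: Nn.
rewrite big_ord_recl expr0 b1 scale1r opprD addrA subrr sub0r.
have -> : \sum_(i < n) beta (lift ord0 i) *: N ^+ lift ord0 i =
    N * \sum_(i < n) beta i.+1 *: N ^+ i.
  rewrite mulr_sumr; apply: eq_bigr => i _.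
  by rewrite [in LHS]exprS [LHS]scalemxAr.
rewrite -mulrN exprMn_comm ?Nn ?mul0r//.
apply/commrN/commr_sum => i _.
rewrite /GRing.comm -[LHS]scalemxAr -[RHS]scalemxAl; congr (_ *: _).
exact: commrX.
Qed.

(** * Quotients of row spaces and the Fitting decomposition *)

Section QuotientMatrices.
Variable F : fieldType.

(** [Q] is the projection modulo the row space of [B] and [S] a linear section. Both come from the
    rank factorisation of [cokermx B], whose free factor [row_base] can be cancelled. *)
Lemma quotient_matrices k (B : 'M[F]_k) :
  exists k' (Q : 'M[F]_(k, k')) (S : 'M[F]_(k', k)),
    [/\ (k' = k - \rank B)%N, S *m Q = 1%:M &
    forall p (M : 'M[F]_(p, k)), (M <= B)%MS = (M *m Q == 0)].
Proof.
have /row_fullP[S SQ] := col_base_full (cokermx B).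
exists (\rank (cokermx B)), (col_base (cokermx B)), S; split => //.
  exact: mxrank_coker.
move=> p M; rewrite -(mulmx_free_eq0 (M *m _) (row_base_free (cokermx B))).
by rewrite -mulmxA mulmx_base submxE.
Qed.

(** As long as the row spaces of the powers shrink, the rank drops by at least one each time; at
    exponent [k.+1] this is no longer possible. *)
Lemma rank_stationary k (f : 'M[F]_k) n :
  (f ^+ k.+1 <= f ^+ (k.+1 + n))%MS.
Proof.
have step j : (f ^+ j <= f ^+ j.+1)%MS || (\rank (f ^+ j) + j <= k)%N.
  elim: j => [|j]; first by rewrite addn0 rank_leq_row orbT.
  have [fj _|nfj /= fk] := boolP (f ^+ j <= f ^+ j.+1)%MS.
    by rewrite !(exprSr f) submxMr// -exprSr.
  apply/orP; right; apply: leq_trans fk; rewrite addnS ltn_add2r.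
  by apply: rank_ltmx; rewrite ltmxE nfj andbT exprS; exact: submxMl.
have fS : (f ^+ k.+1 <= f ^+ k.+2)%MS.
  have := step k.+1; by rewrite addnS ltnNge leq_addl orbF.
elim: n => [|n IH]; first by rewrite addn0.
rewrite addnS (submx_trans fS)//.
by rewrite [f ^+ k.+2]exprSr [f ^+ (_ + n).+1]exprSr submxMr.
Qed.

Lemma trmxX k (f : 'M[F]_k) n : (f ^+ n)^T = f^T ^+ n.
Proof.
elim: n => [|n IH]; first by rewrite !expr0 [LHS]trmx1.
by rewrite exprS [LHS]trmx_mul IH exprSr.
Qed.

(** Stationarity for the transpose says that [B] and its square have the same column space. Hence
    [B *m Z] fixes the row space of [B]. *)
Lemma fitting_inverse k (f : 'M[F]_k) (B := f ^+ k.+1) :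
  exists Z, B = B *m B *m Z.
Proof.
have /submxP[Z fZ] := rank_stationary f^T k.+1.
exists Z^T; apply: trmx_inj.
by rewrite trmx_mul trmxK trmx_mul !trmxX [LHS]fZ exprD.
Qed.

End QuotientMatrices.

(** * Finite generation from a cocycle whose bounded fibres are finite modulo [L] *)

Section Cocycles.
Variables (R : realType) (G : groupType) (D L : set G) (p : nat).
Variable tau : G -> 'rV[R]_p.
Hypotheses (D_subgroup : group_closed [in D]) (L_sub : L `<=` D).
Hypothesis L_fg : finitely_generated L.
Hypothesis tauM : forall g h, D g -> D h -> tau (g * h)%g = tau g + tau h.

(* The affine maps [v |-> v *m rho g + x g] for [g] in [D]; their linear parts
   commute and are controlled by [tau]. *)
Record cocycle k (x : G -> 'rV[R]_k) (rho : G -> 'M[R]_k) : Prop := Cocycle {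
  cocycleM : forall g h, D g -> D h -> x (g * h)%g = x g + x h *m rho g;
  cocycle_rho1 : rho 1%g = 1;
  cocycle_rhoM : forall g h, D g -> D h -> rho (g * h)%g = rho g *m rho h;
  cocycle_rhoC : forall g h, D g -> D h -> rho g *m rho h = rho h *m rho g;
  cocycle_bounded : forall A, A `<=` D -> ebounded A tau -> ebounded A rho }.

(** Everything follows from [QSr]: the defect [1%:M - Q *m S] maps into the row space of [B], which
    is invariant under [rho g] and killed by [Q]. *)
Lemma cocycle_quot k k' (x : G -> 'rV[R]_k) (rho : G -> 'M[R]_k)
    (B : 'M[R]_k) (Q : 'M[R]_(k, k')) (S : 'M[R]_(k', k)) :
    cocycle x rho -> S *m Q = 1%:M ->
    (forall M : 'M[R]_k, (M <= B)%MS = (M *m Q == 0)) ->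
    (forall g, D g -> (B *m rho g <= B)%MS) ->
  cocycle (fun g => x g *m Q) (fun g => S *m rho g *m Q).
Proof.
move=> [xM r1 rM rC rb] SQ BQ Br.
have QSr g : D g -> Q *m (S *m rho g *m Q) = rho g *m Q.
  move=> Dg; have QSB : (1%:M - Q *m S <= B)%MS.
    by rewrite BQ mulmxBl mul1mx -mulmxA SQ mulmx1 subrr.
  have /eqP : (1%:M - Q *m S) *m rho g *m Q == 0.
    by rewrite -BQ (submx_trans _ (Br g Dg))// submxMr.
  by rewrite !mulmxBl mul1mx !mulmxA => /eqP; rewrite subr_eq0 => /eqP.
split.
- by move=> g h Dg Dh; rewrite xM// mulmxDl -(mulmxA _ Q) QSr// mulmxA.
- by rewrite r1 mulmx1 SQ.
- move=> g h Dg Dh; rewrite rM//; apply/esym.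
  by rewrite -(mulmxA _ Q) QSr// !mulmxA.
- move=> g h Dg Dh; rewrite -!(mulmxA _ Q) !QSr// !mulmxA.
  by rewrite -!(mulmxA S) rC.
- move=> A AD At; have Ar := rb A AD At.
  by apply: eboundedM; [apply: eboundedM => //|]; exact: ebounded_cst.
Qed.

(* The coordinates of [x (g ^+ n)] and [rho (g ^+ n)] are polynomials in [n];
   differentiating the cocycle identity at [n = 0] gives an additive map [ell],
   a logarithm, from which [x] is recovered by [x g = ell g *m H g] with [H g]
   a polynomial in [rho g]. *)
Lemma finitely_generated_unipotent k (x : G -> 'rV[R]_k) (rho : G -> 'M[R]_k) m :
    cocycle x rho ->
    (forall g h, D g -> D h -> x (g * h)%g = x (h * g)%g) ->
    (forall A, A `<=` D -> ebounded A x -> ebounded A tau -> finite_mod L A) ->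
    (forall g, D g -> (rho g - 1) ^+ m = 0) ->
  finitely_generated D.
Proof.
move=> [xM r1 rMm rCm rb] xC xF nilp.
have rM g h : D g -> D h -> rho (g * h)%g = rho g * rho h by exact: rMm.
have rC g h : D g -> D h -> rho g * rho h = rho h * rho g by exact: rCm.
pose N g := rho g - 1.
have rN g : rho g = 1 + N g by rewrite addrC subrK.
have rX g n : D g -> rho (g ^+ n)%g = \sum_(l < m) 'C(n, l)%:R *: N g ^+ l.
  move=> Dg; rewrite -(unipotentX (nilp g Dg)) -rN.
  elim: n => [|n IH]; first by rewrite expg0 r1.
  by rewrite expgS rM ?IH ?exprS//; exact: subgroupX.
have x1 : x 1%g = 0.
  have := xM _ _ (subgroup1 D_subgroup) (subgroup1 D_subgroup).
  rewrite mulg1 r1 mulmx1 => /(congr1 (fun z => z - x 1%g)).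
  by rewrite subrr addrK.
have xX g n : D g -> x (g ^+ n)%g = x g *m \sum_(l < m) 'C(n, l.+1)%:R *: N g ^+ l.
  move=> Dg; rewrite -(unipotent_sum (nilp g Dg)) -rN.
  elim: n => [|n IH]; first by rewrite big_ord0 mulmx0.
  rewrite expgSr xM//; last exact: subgroupX.
  rewrite IH big_ord_recr/= mulmxDr; congr (_ + _ *m _).
  elim: n {IH} => [|n IH]; first by rewrite expg0 r1.
  by rewrite expgS rM ?IH ?exprS//; exact: subgroupX.
pose P g i : {poly R} :=
  \sum_(l < m) (x g *m N g ^+ l) 0 i *: binomial_poly R l.+1.
pose Q g i j : {poly R} := \sum_(l < m) (N g ^+ l) i j *: binomial_poly R l.
have PE g i n : D g -> (P g i).[n%:R] = x (g ^+ n)%g 0 i.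
  move=> Dg; rewrite xX// mulmx_sumr summxE /P horner_sum; apply: eq_bigr => l _.
  by rewrite hornerZ horner_binomial_poly -scalemxAr [RHS]mxE mulrC.
have QE g i j n : D g -> (Q g i j).[n%:R] = rho (g ^+ n)%g i j.
  move=> Dg; rewrite rX// summxE /Q horner_sum; apply: eq_bigr => l _.
  by rewrite hornerZ horner_binomial_poly [RHS]mxE mulrC.
have PM g h i : D g -> D h -> P (g * h)%g i = P g i + \sum_j P h j * Q g j i.
  move=> Dg Dh; apply: poly_eq_nat => n; have Dgh := subgroupM D_subgroup Dg Dh.
  rewrite hornerD !PE// horner_sum.
  under eq_bigr do rewrite hornerM PE// QE//.
  (* The elements [g] and [h] need not commute, but [xC] and the commuting linear parts let [x]
     ignore the order of factors. *)
  have -> : x ((g * h) ^+ n)%g = x (g ^+ n * h ^+ n)%g.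
    have xswap a b c d : D a -> D b -> D c -> D d ->
        x (a * b * (c * d))%g = x (a * c * (b * d))%g.
      move=> Da Db Dc Dd;
      have [Dbd Dcd] :=
        (subgroupM D_subgroup Db Dd, subgroupM D_subgroup Dc Dd).
      have Dbc := subgroupM D_subgroup Db Dc; have Dcb := subgroupM D_subgroup Dc Db.
      rewrite -!mulgA !(xM a)//; do ?exact: subgroupM.
      by rewrite (mulgA b) (mulgA c) (xM (b * c)%g)// (xM (c * b)%g)// xC// !rM// rC.
    have rXn a l : D a -> rho (a ^+ l)%g = rho a ^+ l.
      move=> Da; elim: l => [|l IH]; first by rewrite expg0 r1.
      by rewrite expgS rM ?IH ?exprS//; exact: subgroupX.
    elim: n => [|n IH]; first by rewrite !expg0 mulg1.
    have [Xg Xh] := (subgroupX n D_subgroup Dg, subgroupX n D_subgroup Dh).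
    rewrite !expgSr -xswap//.
    rewrite (xM (g ^+ n * h ^+ n)%g)//; last exact: subgroupM.
    rewrite (xM ((g * h) ^+ n)%g)//; last exact: subgroupX.
    rewrite IH rXn// !rM// !rXn//; congr (_ + _ *m _).
    by apply: exprMn_comm; exact: rC.
  by rewrite xM ?mxE//; exact: subgroupX.
(* These coefficients equal (-1)^l / (l + 1), so [M g] is the truncated series of log(1 + N) / N at
   [N g]. *)
pose beta l := (binomial_poly R l.+1)`_1.
pose M g := \sum_(l < m) beta l *: N g ^+ l.
pose ell g := x g *m M g.
have ellE g i : ell g 0 i = (P g i)`_1.
  rewrite /ell mulmx_sumr summxE coef_sum; apply: eq_bigr => l _.
  by rewrite -scalemxAr mxE coefZ mulrC.
have ellM g h : D g -> D h -> ell (g * h)%g = ell g + ell h.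
  move=> Dg Dh; apply/rowP => i; rewrite [RHS]mxE !ellE PM// coefD; congr (_ + _).
  (* The constant terms are the values at the zeroth power: zero for [P h j], an entry of the
     identity for [Q g j i]. *)
  have PQ j : (P h j * Q g j i)`_1 = (P h j)`_1 * (j == i)%:R.
    rewrite coefM big_ord_recl big_ord1/= -!horner_coef0.
    rewrite (PE _ _ 0%N)// (QE _ _ _ 0%N)// !expg0 x1 r1 !mxE mul0r add0r.
    by rewrite mulr_natr.
  rewrite coef_sum (bigD1 i)//= PQ eqxx mulr1 big1 ?addr0// => j ji.
  by rewrite PQ (negPf ji) mulr0.
(* The Neumann series for the inverse of [M g], finite because [1 - M g] is nilpotent. *)
pose H g := \sum_(l < m) (1 - M g) ^+ l.
have MH g : D g -> M g * H g = 1.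
  move=> Dg; suff M1 : (1 - M g) ^+ m = 0.
    have := subrX1 (1 - M g) m; rewrite M1 sub0r addrAC subrr sub0r mulNr.
    by move=> /oppr_inj.
  by rewrite /M nilpotent_one_sub ?nilp// /beta binomial_poly1 coefX.
have MHm g : D g -> x g = ell g *m H g.
  by move=> Dg; rewrite /ell -mulmxA (MH g Dg : M g *m H g = 1%:M) mulmx1.
apply: (@finitely_generated_hom _ _ D L _ (fun g => row_mx (ell g) (tau g))) => //.
  by move=> g h Dg Dh; rewrite ellM// tauM// add_row_mx.
move=> A AD Aet; have At := ebounded_rsub Aet; have Ar := rb A AD At.
apply: xF => //; apply: (@ebounded_eq _ _ _ _ _ (fun g => ell g *m H g)).
  by move=> g /AD Dg; rewrite -MHm.
apply: eboundedM; first exact: ebounded_lsub Aet.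
apply: ebounded_sum => l; apply/eboundedX/eboundedB; first exact: ebounded_cst.
apply: ebounded_sum => i; apply/eboundedZ/eboundedX/eboundedB => //.
exact: ebounded_cst.
Qed.

(* If [f = rho s - 1] is not nilpotent, commutativity bounds [x g *m f], hence
   the component of [x g] in the Fitting summand on which [f] is invertible;
   this summand can be divided out. *)
Lemma finitely_generated_cocycle k (x : G -> 'rV[R]_k) (rho : G -> 'M[R]_k) :
    cocycle x rho ->
    (forall g h, D g -> D h -> x (g * h)%g = x (h * g)%g) ->
    (forall A, A `<=` D -> ebounded A x -> ebounded A tau -> finite_mod L A) ->
  finitely_generated D.
Proof.
elim/ltn_ind: k x rho => k IH x rho xrho xC xF.
have [nilp|] := pselect (forall g, D g -> (rho g - 1) ^+ k.+1 = 0).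
  exact: finitely_generated_unipotent xrho xC xF nilp.
move=> /existsNP[s /not_implyP[Ds B0]].
pose f := rho s - 1; pose B := f ^+ k.+1.
have [Z BZ] := fitting_inverse f.
have [k' [Q [S [k'E SQ BQ]]]] := quotient_matrices B.
have [xM r1 rM rC rb] := xrho.
have fr g : D g -> GRing.comm (rho g) f.
  by move=> Dg; apply: commrB; [exact: rC|exact: commr1].
have Br g : D g -> (B *m rho g <= B)%MS.
  move=> Dg; have -> : B *m rho g = rho g *m B.
    by apply: commr_sym; exact/commrX/fr.
  exact: submxMl.
(* Expanding [x (g * s)] and [x (s * g)] by the cocycle rule. As [s] is fixed, the right side is
   bounded in terms of [tau]. *)
have xf g : D g -> x g *m f = x s *m (rho g - 1).
  move=> Dg; have := xC _ _ Dg Ds; rewrite !xM// /f !mulmxBr !mulmx1 => e.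
  by apply/eqP; rewrite subr_eq addrAC eq_sym subr_eq [eqbLHS]addrC e addrC.
have k'k : (k' < k)%N.
  have rB : (0 < \rank B)%N by rewrite lt0n mxrank_eq0; exact/eqP.
  by rewrite k'E ltn_subrL rB (leq_trans rB)// rank_leq_row.
apply: (IH _ k'k _ _ (cocycle_quot xrho SQ (fun M => BQ _ M) Br)).
  by move=> g h Dg Dh; rewrite xC.
move=> A AD AxQ At; apply: xF => //.
have Ar := rb A AD At.
have QS_B : ((1%:M - Q *m S) *m B *m Z = 1%:M - Q *m S).
  have /submxP[Y ->] : (1%:M - Q *m S <= B)%MS.
    by rewrite BQ mulmxBl mul1mx -mulmxA SQ mulmx1 subrr.
  by rewrite -(mulmxA Y) -(mulmxA Y) -BZ.
have xB g : D g -> x g *m B = x s *m ((rho g - 1) *m f ^+ k).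
  move=> Dg; have -> : B = f *m f ^+ k by rewrite /B exprS.
  by rewrite mulmxA xf// mulmxA.
(* The value [x g] splits into its lift from the quotient, bounded by assumption, and a part in the
   row space of [B], recovered from its image under [B] by means of [Z]. *)
apply: (@ebounded_eq _ _ _ _ _ (fun g =>
    x g *m Q *m S + (x s *m ((rho g - 1) *m f ^+ k) - x g *m Q *m S *m B) *m Z)).
  move=> g /AD Dg; rewrite -xB//.
  have -> : x g *m B - x g *m Q *m S *m B = x g *m ((1%:M - Q *m S) *m B).
    by rewrite mulmxBl mul1mx mulmxBr !mulmxA.
  by rewrite -(mulmxA _ (_ *m B)) QS_B mulmxBr mulmx1 mulmxA addrC subrK.
have AxQS : ebounded A (fun g => x g *m Q *m S).
  by apply: eboundedM => //; exact: ebounded_cst.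
apply: eboundedD => //; apply: eboundedM; last exact: ebounded_cst.
apply: eboundedB; last by apply: eboundedM => //; exact: ebounded_cst.
apply: eboundedM; first exact: ebounded_cst.
apply: eboundedM; last exact: ebounded_cst.
by apply: eboundedB => //; exact: ebounded_cst.
Qed.

End Cocycles.

(* The kernel [L] of [tau] is a lattice in its real span, which is divided out;
   bounded subsets of the quotient lift to bounded sets modulo [L]. *)
Lemma finitely_generated_discrete_cocycle (R : realType) (G : groupType) (D : set G) p k
    (tau : G -> 'rV[R]_p) (x : G -> 'rV[R]_k) (rho : G -> 'M[R]_k) :
    group_closed [in D] ->
    (forall g h, D g -> D h -> tau (g * h)%g = tau g + tau h) ->
    cocycle D tau x rho ->
    (forall g, D g -> tau g = 0 -> rho g = 1) ->
    (forall A, A `<=` D -> ebounded A x -> ebounded A tau -> finite_set A) ->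
  finitely_generated D.
Proof.
move=> Dg tauM xrho rho_ker fin.
have [xM r1 rM rC rb] := xrho.
have tau1 : tau 1%g = 0.
  have := tauM _ _ (subgroup1 Dg) (subgroup1 Dg).
  by rewrite mulg1 => /(congr1 (fun z => z - tau 1%g)); rewrite subrr addrK.
have tauV g : D g -> tau (g^-1)%g = - tau g.
  move=> gD; have := tauM _ _ (subgroupV Dg gD) gD.
  by rewrite mulVg tau1 => /esym/eqP; rewrite addr_eq0 => /eqP.
pose L := [set g | D g /\ tau g = 0].
have LD : L `<=` D by move=> g [].
have Lg : group_closed [in L].
  apply: subgroupP; first by split => //; exact: subgroup1.
  move=> g h [gD g0] [hD h0]; have hVD := subgroupV Dg hD.
  by split; [exact: subgroupM|rewrite tauM// tauV// g0 h0 oppr0 addr0].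
have xLM g h : L g -> D h -> x (g * h)%g = x g + x h.
  by move=> [gD g0] hD; rewrite xM// rho_ker// mulmx1.
have x1 : x 1%g = 0.
  have := xLM _ _ (subgroup1 Lg) (subgroup1 Dg).
  by rewrite mulg1 => /(congr1 (fun z => z - x 1%g)); rewrite subrr addrK.
have xLV g : L g -> x (g^-1)%g = - x g.
  move=> gL; have := xLM _ _ (subgroupV Lg gL) (LD _ gL).
  by rewrite mulVg x1 => /esym/eqP; rewrite addr_eq0 => /eqP.
(* On [L] the map [x] is additive and [tau] vanishes, so the lattice argument applies over the
   trivial subgroup. *)
have L_fg : finitely_generated L.
  apply: (@finitely_generated_hom _ _ L [set 1%g] _ x) => //.
  - exists set0 => //; apply/seteqP; split.
      by move=> _ -> H [Hg _]; exact: subgroup1.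
    move=> g; apply; split => //; apply: subgroupP => // _ _ -> ->.
    by rewrite mulgV.
  - by move=> _ ->; exact: subgroup1.
  - by move=> g h gL hL; rewrite xLM//; exact: LD.
  - move=> A AL Ax; exists A; last first.
      by move=> g Ag; exists g => //=; rewrite mulgV.
    apply: fin => //; first exact: subset_trans LD.
    by exists 0 => g /AL[_ ->] i j; rewrite mxE normr0.
have [m [b [Lb Lspan]]] := exists_spanning_family L x.
pose B := (<<\matrix_i x (b i)>>)%MS.
have [k' [Q [S [_ SQ BQ]]]] := quotient_matrices B.
have LB g : L g -> (x g <= B)%MS by move=> /Lspan; rewrite genmxE.
have Br g : D g -> (B *m rho g <= B)%MS.
  move=> gD; rewrite (eqmxMr _ (genmxE _)); apply/row_subP => i.
  have [bD b0] := Lb i; have gVD := subgroupV Dg gD.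
  rewrite row_mul rowK.
  (* Conjugation by [g] preserves [L] and acts on its image through [rho g]; hence the span is
     invariant. *)
  have -> : x (b i) *m rho g = x (g * (b i * g^-1))%g.
    rewrite xM ?xLM//; last exact: subgroupM.
    rewrite mulmxDl addrCA -xM// mulgV x1 addr0 //.
  apply: LB; split; first by do 2?apply: subgroupM.
  by rewrite !tauM ?tauV//; [rewrite b0 add0r subrr|exact: subgroupM].
apply: (@finitely_generated_cocycle _ _ D L _ tau Dg LD L_fg tauM k'
  (fun g => x g *m Q) (fun g => S *m rho g *m Q)).
- exact: cocycle_quot xrho SQ (fun M => BQ _ M) Br.
- move=> g h gD hD; have [ghD hgD] := (subgroupM Dg gD hD, subgroupM Dg hD gD).
  (* Commutators are in the kernel of [tau], so [x] cannot see them modulo [B]. *)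
  have cL : L ((g * h) * (h * g)^-1)%g.
    have hgVD := subgroupV Dg hgD; split; first exact: subgroupM.
    by rewrite tauM// tauV// !tauM// [tau h + _]addrC subrr.
  have := LB _ cL; rewrite BQ => /eqP xc.
  rewrite -(mulgVK (h * g)%g (g * h)%g) xLM// mulmxDl xc add0r //.
move=> A AD [u xu] [v tv].
(* Translates of elements of [A] by [L] whose component along the span has coefficients of size at
   most 1. They are bounded, hence finite in number, and serve as coset representatives. *)
pose A' := [set h | D h /\ exists2 l, L l & A (l * h)%g /\
  exists c : 'rV_m, (forall i, `|c 0 i| <= 1) /\
    x h = x (l * h)%g *m Q *m S + c *m \matrix_i x (b i)].
exists A'.
  apply: fin; first by move=> g [].
    (* The witnesses become functions on all of [G], with default value 0 outside [A']. *)
    have /choice[zc zcP] : forall h, exists zc : 'rV_k' * 'rV_m, A' h ->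
        [/\ forall i j, `|zc.1 i j| <= u, forall i j, `|zc.2 i j| <= 1 &
        x h = zc.1 *m S + zc.2 *m \matrix_i x (b i)].
      move=> h; have [[hD [l lL [Alh [c [c1 xE]]]]]|nA'] := pselect (A' h);
        last by exists 0.
      exists (x (l * h)%g *m Q, c) => _; split => //= i j; first exact: xu.
      by rewrite (ord1 i).
    apply: (@ebounded_eq _ _ _ _ _
      (fun h => (zc h).1 *m S + (zc h).2 *m \matrix_i x (b i))).
      by move=> h /zcP[].
    apply: eboundedD; (apply: eboundedM; last exact: ebounded_cst).
      by exists u => h /zcP[].
    by exists 1 => h /zcP[].
  exists v => h [hD [l [lD l0] [Alh _]]] i j.
  by have := tv _ Alh i j; rewrite tauM// l0 add0r.
move=> g Ag; have gD := AD _ Ag.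
have : (x g *m (1%:M - Q *m S) <= \matrix_i x (b i))%MS.
  rewrite -(genmxE (\matrix_i x (b i))) BQ -mulmxA mulmxBl mul1mx -mulmxA SQ.
  by rewrite mulmx1 subrr mulmx0.
move=> /submxP[a ga].
(* [l] absorbs the integral part of the component of [x g] along the span, so that [l^-1 * g] falls
   into [A']. *)
have [|l [lL lH [c [c1 cE]]]] := @integral_part R G L k x m b (a 0) Lg _ Lb.
  by move=> y z yL zL; apply: xLM => //; exact: LD.
have lD := LD _ lL; have lVD := subgroupV Dg lD.
exists (l^-1 * g)%g; last by rewrite /= invgM invgK mulVKg.
split; first exact: subgroupM.
exists l => //; rewrite mulVKg; split => //; exists (\row_i c i); split => [i|].
  by rewrite mxE.
rewrite xLM ?xLV//; last exact: subgroupV.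
have -> : (\row_i c i) *m (\matrix_i x (b i)) = \sum_i c i *: x (b i).
  rewrite mulmx_sum_row; apply: eq_bigr => i _.
  by congr (_ *: _); [rewrite mxE|exact: rowK].
have aE : a *m (\matrix_i x (b i)) = \sum_i a 0 i *: x (b i).
  by rewrite mulmx_sum_row; apply: eq_bigr => i _; congr (_ *: _); exact: rowK.
move: ga; rewrite aE cE mulmxBr mulmx1 mulmxA => /eqP; rewrite subr_eq => /eqP xgE.
by rewrite [in LHS]xgE -addrA addKr addrC.
Qed.

(** * Discrete subgroups of almost Abelian groups *)

(** Pigeonhole: cut each coordinate range from [- r] to [r] into cells of length [e]. Two points
    with the same cells are closer than [e], hence equal, and [K] bounds the cell index. *)
Lemma finite_separated (R : realType) T n (f : T -> 'rV[R]_n) (A : set T) e :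
    0 < e -> ebounded A f ->
    (forall a b, A a -> A b -> (forall j, `|f a 0 j - f b 0 j| < e) -> a = b) ->
  finite_set A.
Proof.
move=> e0 [r fr] sep.
pose z a j := Num.floor ((f a 0 j + r) / e).
pose K := Num.truncn (2 * r / e).
have zP a j : A a -> exists2 k : nat, (k <= K)%N & z a j = k.
  move=> Aa; have := fr _ Aa 0 j; rewrite ler_norml => /andP[lo hi].
  have p0 : 0 <= (f a 0 j + r) / e by rewrite divr_ge0 ?(ltW e0)// -lerBlDr sub0r.
  have -> : z a j = Num.truncn ((f a 0 j + r) / e).
    by rewrite truncn_floor p0 /z gez0_abs ?floor_ge0.
  exists (Num.truncn ((f a 0 j + r) / e)) => //.
  apply: le_truncn; rewrite ler_wpM2r ?invr_ge0 ?(ltW e0)//.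
  by rewrite mulr_natl mulr2n lerD2r.
pose code a : {ffun 'I_n -> 'I_K.+1} := [ffun j => inord `|z a j|%N].
have codeI : {in A &, injective code}.
  move=> a b /set_mem Aa /set_mem Ab /ffunP ab; apply: sep => // j.
  have [k kK zk] := zP a j Aa; have [l lK zl] := zP b j Ab.
  have := ab j; rewrite !ffunE zk zl !absz_nat => /(congr1 val)/=.
  rewrite !inordK ?ltnS// => kl.
  have zz : z a j = z b j by rewrite zk zl kl.
  have : `|(f a 0 j + r) / e - (f b 0 j + r) / e| < 1.
    have := floor_le_tmp ((f a 0 j + r) / e); have := floor_le_tmp ((f b 0 j + r) / e).
    have := floorD1_gt ((f a 0 j + r) / e); have := floorD1_gt ((f b 0 j + r) / e).
    rewrite -/(z a j) -/(z b j) zz intrD ltr_norml => h1 h2 h3 h4.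
    by apply/andP; split; lra.
  by rewrite -mulrBl opprD addrACA subrr addr0 normrM normfV
    (gtr0_norm e0) ltr_pdivrMr// mul1r.
by rewrite -(eq_finite_set (inj_card_eq codeI)).
Qed.

(** * Real coordinates for complex vectors and matrices *)

Section Realification.
Variable R : realType.

(* Coordinates are row vectors acted on from the right, so products are
   reversed. *)
Definition realify_mx p q (M : 'M[cplx R]_(p, q)) : 'M[R]_(q + q, p + p) :=
  let A := map_mx (@complex.Re R) (M : 'M[R[i]%C]_(p, q)) in
  let B := map_mx (@complex.Im R) (M : 'M[R[i]%C]_(p, q)) in
  block_mx A^T B^T (- B^T) A^T.

Definition realify p (v : 'cV[cplx R]_p) : 'rV[R]_(p + p) :=
  row_mx (map_mx (@complex.Re R) (v : 'M[R[i]%C]_(p, 1)))^T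
         (map_mx (@complex.Im R) (v : 'M[R[i]%C]_(p, 1)))^T.

Lemma Re_sum I (r : seq I) (F : I -> R[i]%C) :
  complex.Re (\sum_(i <- r) F i) = \sum_(i <- r) complex.Re (F i).
Proof. by apply: (big_morph (@complex.Re R)) => // [[? ?] [? ?]]. Qed.

Lemma Im_sum I (r : seq I) (F : I -> R[i]%C) :
  complex.Im (\sum_(i <- r) F i) = \sum_(i <- r) complex.Im (F i).
Proof. by apply: (big_morph (@complex.Im R)) => // [[? ?] [? ?]]. Qed.

Lemma map_Re_mul p q s (M : 'M[R[i]%C]_(p, q)) (N : 'M[R[i]%C]_(q, s)) :
  map_mx (@complex.Re R) (M *m N) =
  map_mx (@complex.Re R) M *m map_mx (@complex.Re R) N -
  map_mx (@complex.Im R) M *m map_mx (@complex.Im R) N.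
Proof.
apply/matrixP => i j; rewrite !mxE Re_sum -sumrB; apply: eq_bigr => k _.
by rewrite !mxE; case: (M i k) => ? ?; case: (N k j).
Qed.

Lemma map_Im_mul p q s (M : 'M[R[i]%C]_(p, q)) (N : 'M[R[i]%C]_(q, s)) :
  map_mx (@complex.Im R) (M *m N) =
  map_mx (@complex.Re R) M *m map_mx (@complex.Im R) N +
  map_mx (@complex.Im R) M *m map_mx (@complex.Re R) N.
Proof.
apply/matrixP => i j; rewrite !mxE Im_sum -big_split; apply: eq_bigr => k _.
by rewrite !mxE; case: (M i k) => ? ?; case: (N k j).
Qed.

Lemma realify_mul p q (M : 'M[cplx R]_(p, q)) (v : 'cV[cplx R]_q) :
  realify (M *m v) = realify v *m realify_mx M.
Proof.
rewrite /realify /realify_mx [map_mx _ (M *m v)]map_Re_mul.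
rewrite [map_mx _ (M *m v)]map_Im_mul mul_row_block mulmxN.
by rewrite !(linearB, linearD)/= !trmx_mul addrC [X in row_mx _ X]addrC.
Qed.

Lemma realifyD p (v w : 'cV[cplx R]_p) : realify (v + w) = realify v + realify w.
Proof.
rewrite /realify add_row_mx -!linearD/=.
by congr (row_mx _^T _^T); apply/matrixP => i j; rewrite !mxE;
  case: (v i j) => ? ?; case: (w i j).
Qed.

Lemma realifyB p (v w : 'cV[cplx R]_p) : realify (v - w) = realify v - realify w.
Proof. by apply/eqP; rewrite eq_sym subr_eq -realifyD subrK. Qed.

Lemma realify_mxM p q s (M : 'M[cplx R]_(p, q)) (N : 'M[cplx R]_(q, s)) :
  realify_mx (M *m N) = realify_mx N *m realify_mx M.
Proof.
rewrite /realify_mx [map_mx _ (M *m N)]map_Re_mul.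
rewrite [map_mx _ (M *m N)]map_Im_mul mulmx_block !(mulmxN, mulNmx).
rewrite !(linearB, linearD)/= !trmx_mul.
by congr block_mx; rewrite 1?addrC// opprD addrC.
Qed.

Lemma realify_mx1 p : realify_mx (1%:M : 'M[cplx R]_p) = 1%:M.
Proof.
have Re1 : map_mx (@complex.Re R) (1%:M : 'M[R[i]%C]_p) = 1%:M.
  by apply/matrixP => i j; rewrite !mxE; case: (i == j).
have Im1 : map_mx (@complex.Im R) (1%:M : 'M[R[i]%C]_p) = 0.
  by apply/matrixP => i j; rewrite !mxE; case: (i == j).
rewrite /realify_mx [map_mx _ 1%:M]Re1 [map_mx _ 1%:M]Im1 trmx0 trmx1 oppr0.
by rewrite [RHS]scalar_mx_block.
Qed.

Lemma realify_mxX d (M : 'M[cplx R]_d) n : realify_mx (M ^+ n) = realify_mx M ^+ n.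
Proof.
elim: n => [|n IH]; first by rewrite !expr0 [LHS]realify_mx1.
by rewrite exprS exprSr -IH [LHS]realify_mxM.
Qed.

Lemma realify_mx_le p q (M : 'M[cplx R]_(p, q)) r :
  (forall i j, normc (M i j : R[i]%C) <= r) -> forall i j, `|realify_mx M i j| <= r.
Proof.
move=> Mr i j; rewrite /realify_mx !mxE.
case: fintype.split => i'; rewrite !mxE; case: fintype.split => j'; rewrite !mxE ?normrN;
  by apply: le_trans (Mr j' i'); rewrite ?Re_le_normc ?Im_le_normc.
Qed.

Lemma normc_le_realify p (v : 'cV[cplx R]_p) r :
  (forall j, `|realify v 0 j| <= r) -> forall i, normc (v i 0 : R[i]%C) <= r *+ 2.
Proof.
move=> vr i; apply: le_trans (normc_le_ReIm _) _; rewrite mulr2n lerD//.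
  by have := vr (lshift _ i); rewrite row_mxEl !mxE.
by have := vr (rshift _ i); rewrite row_mxEr !mxE.
Qed.

End Realification.

Lemma mx_scalerX (K : comPzRingType) d (z : K) (J : 'M[K]_d) k :
  (z *: J) ^+ k = z ^+ k *: J ^+ k.
Proof.
elim: k => [|k IH]; first by rewrite !expr0 scale1r.
by rewrite exprS IH -[LHS]scalemxAl -[X in _ *: X]scalemxAr scalerA !exprS.
Qed.

Lemma normc_sum (R : realType) I (r : seq I) (F : I -> R[i]%C) :
  normc (\sum_(i <- r) F i) <= \sum_(i <- r) normc (F i).
Proof.
elim/big_rec2 : _ => [|i a b _ ab]; first by rewrite [X in X <= _]normc0.
by apply: le_trans (le_normcD _ _) _; rewrite lerD2l.
Qed.

Lemma normc_nat (R : realType) n : normc (n%:R : R[i]%C) = n%:R.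
Proof.
have -> : (n%:R : R[i]%C) = ((n%:R : R)%:C)%C.
  by rewrite [RHS](rmorph_nat (real_complex R)).
by rewrite /= expr0n/= addr0 sqrtr_sqr ger0_norm.
Qed.

(** * A Lipschitz estimate for the matrix exponential at the origin *)

Section ExponentialBounds.
Variable R : realType.
Local Notation C := (cplx R).

Let nc (z : C) : R := normc (z : R[i]%C).

Let nc_expr d (J : 'M[C]_d) (a := \sum_i \sum_j nc (J i j)) k i j :
  nc ((J ^+ k) i j) <= a ^+ k.
Proof.
have nc0 z : 0 <= nc z := normc_ge0 _.
elim: k i j => [|k IH] i j.
  rewrite !expr0 mxE; case: (i == j); rewrite /nc ?mulr1n ?mulr0n.
    by rewrite [X in X <= _]normc1.
  by rewrite [X in X <= _]normc0.
rewrite !exprS mxE; apply: le_trans (normc_sum _ _) _.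
apply: (@le_trans _ _ (\sum_l nc (J i l) * a ^+ k)).
  by apply: ler_sum => l _; rewrite /nc [X in X <= _]normcM ler_wpM2l.
rewrite -mulr_suml ler_wpM2r ?exprn_ge0//.
  by do 2! (apply: sumr_ge0 => ? _).
rewrite /a [leRHS](bigD1 i)//= lerDl; by do 2! (apply: sumr_ge0 => ? _).
Qed.

Let nc_factV k : nc (k`!%:R^-1) = k`!%:R^-1.
Proof. by rewrite /nc [LHS]normcV normc_nat. Qed.

Let ncX z k : nc (z ^+ k) = nc z ^+ k.
Proof.
elim: k => [|k IH]; first by rewrite !expr0 /nc [LHS]normc1.
by rewrite !exprS /nc [LHS]normcM -IH.
Qed.

(** In the unit disc each positive power of [z] has modulus at most that of [z], so the series
    without its constant term is dominated by the modulus of [z] times the real exponential series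
    at [a]. *)
Lemma expmx_sub1_le d (J : 'M[C]_d) : exists2 c, 0 <= c & forall z : C, nc z <= 1 ->
  forall i j, nc ((expmx (z *: J) - 1) i j) <= c * nc z.
Proof.
have nc0 z : 0 <= nc z := normc_ge0 _.
pose a := \sum_i \sum_j nc (J i j).
have a0 : 0 <= a by do 2! (apply: sumr_ge0 => ? _).
exists (expR a); first exact: expR_ge0.
move=> z z1 i j.
pose u n := series (fun k => (k`!%:R)^-1 *: (z *: J) ^+ k) n : 'M[C]_d.
have uE n : nc ((u n.+1 - 1) i j) <= expR a * nc z.
  rewrite /u /series/= big_nat_recl// expr0 fact0 invr1 scale1r addrAC subrr add0r.
  rewrite summxE; apply: le_trans (normc_sum _ _) _.
  apply: (@le_trans _ _ (\sum_(0 <= k < n) (exp_coeff a k.+1) * nc z)).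
    apply: ler_sum => k _; rewrite mx_scalerX 2!mxE.
    rewrite /nc [X in X <= _]normcM [X in _ * X <= _]normcM -!/(nc _) nc_factV.
    rewrite /exp_coeff/= (mulrC (a ^+ _)) -[leRHS]mulrA ler_wpM2l ?invr_ge0//.
    rewrite [leRHS]mulrC ncX ler_pM ?exprn_ge0// exprS ler_piMr//.
    by rewrite exprn_ile1.
  rewrite -mulr_suml ler_wpM2r//.
  apply: le_trans (nondecreasing_cvgn_le _ (is_cvg_series_exp_coeff a) n.+1).
    rewrite /series/= [leRHS]big_nat_recl// lerDr; exact: exp_coeff_ge0.
  by apply: nondecreasing_series => k _ _; exact: exp_coeff_ge0.
apply/ler_addgt0Pr => e e0.
have := @cvg_mxE R d _ _ i j (@cvg_expmx R d (z *: J)).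
move=> /cvgrPdist_lt/(_ (e%:C)%C).
have -> : 0 < (e%:C)%C :> C by rewrite ltcR.
move=> /(_ isT)[n _ /(_ n.+1 (leqnSn n))]; rewrite ltcE/= => /andP[_ un].
have -> : expmx (z *: J) - 1 = (u n.+1 - 1) + (expmx (z *: J) - u n.+1).
  by rewrite [RHS]addrC addrA subrK.
rewrite mxE; apply: le_trans (le_normcD _ _) _; rewrite lerD ?uE//.
have -> : (expmx (z *: J) - u n.+1) i j = expmx (z *: J) i j - u n.+1 i j.
  by rewrite [LHS]mxE [X in _ + X]mxE.
exact: ltW un.
Qed.

End ExponentialBounds.

(** * The cocycle of an almost Abelian group and the use of discreteness *)

Section DiscreteSubgroups.
Variables (R : realType) (d : nat) (J : 'M[cplx R]_d).
Local Notation C := (cplx R).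
Local Notation G := (almost_abelian_group J).
Let nc (z : C) : R := normc (z : R[i]%C).
Let nc0 z : 0 <= nc z := normc_ge0 _.

Definition vector_coords (g : G) : 'rV[R]_(d + d) := realify g.1.
Definition time_coords (g : G) : 'rV[R]_(1 + 1) := realify (const_mx g.2).
Definition linear_part (g : G) : 'M[R]_(d + d) := realify_mx (expmx (g.2 *: J)).

Lemma time_coordsM (g h : G) :
  time_coords (g * h)%g = time_coords g + time_coords h.
Proof.
rewrite /time_coords -realifyD; congr realify.
by apply/matrixP => i j; rewrite !mxE.
Qed.

Lemma nc_time (g : G) r :
  (forall i j, `|time_coords g i j| <= r) -> nc g.2 <= r *+ 2.
Proof.
move=> gr; have := normc_le_realify (gr 0) 0; by rewrite mxE.
Qed.

Lemma linear_partM (g h : G) :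
  linear_part (g * h)%g = linear_part g *m linear_part h.
Proof. by rewrite /linear_part -realify_mxM -expmxDJ addrC. Qed.

Lemma linear_partC (g h : G) :
  linear_part g *m linear_part h = linear_part h *m linear_part g.
Proof.
rewrite /linear_part -[LHS]realify_mxM -[RHS]realify_mxM.
by rewrite -[in LHS]expmxDJ addrC expmxDJ.
Qed.

Lemma expmxX (z : C) n : expmx (z *: J) ^+ n = expmx ((z *+ n) *: J).
Proof.
elim: n => [|n IH]; first by rewrite expr0 mulr0n scale0r expmx0.
by rewrite exprS IH mulrS expmxDJ.
Qed.

(** The estimate near the identity covers times in the unit disc only, so all times are divided by a
    common [n] and the exponential is recovered as an [n]-th power. *)
Lemma linear_part_bounded (A : set G) :
  ebounded A time_coords -> ebounded A linear_part.
Proof.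
move=> [r tr]; have [c c0 cP] := expmx_sub1_le J.
pose n := (Num.truncn (r *+ 2)).+1.
have rn : r *+ 2 < n%:R by exact: truncnS_gt.
have n0 : (n%:R : C) != 0 by rewrite pnatr_eq0.
pose z (g : G) : C := g.2 / n%:R.
apply: (@ebounded_eq _ _ _ _ _ (fun g => realify_mx (expmx (z g *: J)) ^+ n)).
  by move=> g _; rewrite -realify_mxX expmxX -mulr_natr divfK.
apply: eboundedX; exists (c + 1) => g Ag; apply: realify_mx_le => i j.
have zg : nc (z g) <= 1.
  rewrite /nc [X in X <= _]normcM [X in _ * X <= _]normcV [X in _ * X^-1 <= _]normc_nat.
  by rewrite ler_pdivrMr ?ltr0n// mul1r ltW// (le_lt_trans (nc_time (tr _ Ag))).
have -> : expmx (z g *: J) i j = (expmx (z g *: J) - 1) i j + (1 : 'M[C]_d) i j.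
  by rewrite !mxE subrK.
apply: le_trans (le_normcD _ _) _; rewrite lerD//.
  by apply: le_trans (cP _ zg i j) _; rewrite ler_piMr.
rewrite mxE; case: (i == j); first by rewrite [X in X <= _]normc1.
by rewrite [X in X <= _]normc0.
Qed.

Lemma vector_coordsM (g h : G) :
  vector_coords (g * h)%g = vector_coords g + vector_coords h *m linear_part g.
Proof. by rewrite /vector_coords realifyD realify_mul. Qed.

Lemma cocycle_almost_abelian (D : set G) :
  cocycle D time_coords vector_coords linear_part.
Proof.
split.
- by move=> g h _ _; exact: vector_coordsM.
- by rewrite /linear_part scale0r expmx0 [LHS]realify_mx1.
- by move=> g h _ _; exact: linear_partM.
- by move=> g h _ _; exact: linear_partC.
- by move=> A _; exact: linear_part_bounded.
Qed.

Lemma nbhs1_coords (U : set G) : nbhs (1%g : G) U ->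
  exists2 e : R, 0 < e & forall g : G,
    (forall i, nc (g.1 i 0) < e) -> nc g.2 < e -> U g.
Proof.
case=> -[P Q] [P0 Q0] PQ.
have [a a0 aP] : nbhs_ball (0 : 'cV[C]_d) P by apply/nbhs_ballP; exact: P0.
have [b b0 bQ] : nbhs_ball (0 : C) Q by apply/nbhs_ballP; exact: Q0.
(* Radii of balls are positive elements of [C], hence real. *)
have pos (z : C) : 0 < z -> z = ((complex.Re z)%:C)%C /\ 0 < complex.Re z.
  by case: z => u v; rewrite ltcE/= => /andP[/eqP -> ->].
have [aE aR] := pos _ a0; have [bE bR] := pos _ b0.
have ball0 (z : C) r : nc z < r -> ball (0 : C) (r%:C)%C z.
  by move=> zr; rewrite -ball_normE/= sub0r normrN ltcR.
exists (Num.min (complex.Re a) (complex.Re b)); first by rewrite lt_min aR.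
move=> g g1 g2; apply: PQ; split => /=.
  apply: aP; split => // i j; rewrite mxE (ord1 j) aE; apply: ball0.
  by have := g1 i; rewrite lt_min => /andP[].
apply: bQ; rewrite bE; apply: ball0.
by move: g2; rewrite lt_min => /andP[].
Qed.

(** Isolates the contribution of the linear part, which is small when the times are close and [h.1]
    is bounded. *)
Lemma fst_divg (g h : G) :
  (g * h^-1)%g.1 = (g.1 - h.1) - (expmx ((g.2 - h.2) *: J) - 1) *m h.1.
Proof.
rewrite mulmxBl mul1mx opprB addrA subrK expmxDJ -mulmxA -mulmxN.
by [].
Qed.

(** If [g] and [h] have close coordinates within a bounded set, [g * h^-1] enters a neighbourhood
    isolating the identity, so [g = h]. Thus [A] is separated and bounded. *)
Lemma discrete_bounded_finite (D : set G) (A : set G) :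
    group_closed [in D] -> discrete_subset D -> A `<=` D ->
    ebounded A vector_coords -> ebounded A time_coords ->
  finite_set A.
Proof.
move=> Dg Ddisc AD Ax At.
have [_ [U U1 UD]] := Ddisc _ (subgroup1 Dg).
have [e e0 eU] := nbhs1_coords U1.
have [c c0 cP] := expmx_sub1_le J.
have [r xr] := Ax.
have hr (h : G) : A h -> forall i, nc (h.1 i 0) <= `|r| *+ 2.
  move=> Ah; apply: normc_le_realify => j; exact: le_trans (xr _ Ah 0 j) (ler_norm r).
(* The summand 1 accounts for [g.1 - h.1] in [fst_divg], the sum for the exponential term. *)
pose K := 1 + \sum_(j < d) c * (`|r| *+ 2).
have K0 : 0 < K.
  by rewrite ltr_pwDl// sumr_ge0// => _ _; rewrite mulr_ge0// mulrn_wge0.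
(* The first bound keeps time differences in the unit disc, the second makes [eta *+ 2 * K] at most
   half of [e]; the doubling comes from passing from real coordinates to moduli. *)
pose eta := Num.min 2^-1 (e / (4 * K)).
have eta0 : 0 < eta by rewrite lt_min invr_gt0 ltr0n divr_gt0// mulr_gt0.
have eta_half : eta *+ 2 <= 1.
  by rewrite -(mulr_natr eta) -ler_pdivlMr// div1r ge_min lexx.
have etaK : eta *+ 2 * K < e.
  have : eta <= e / (4 * K) by rewrite ge_min lexx orbT.
  rewrite ler_pdivlMr ?mulr_gt0// => h.
  by have := mulr_gt0 eta0 K0; rewrite -(mulr_natr eta); lra.
apply: (@finite_separated _ _ _
  (fun g => row_mx (vector_coords g) (time_coords g)) _ eta) => //.
  have [s ts] := At; exists (Num.max r s) => g Ag i j; rewrite mxE (ord1 i) le_max.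
  by case: fintype.split => k; [rewrite xr|rewrite ts ?orbT].
move=> g h Ag Ah gh.
have t_gh : nc (g.2 - h.2) <= eta *+ 2.
  have : forall j, `|realify (const_mx (g.2 - h.2) : 'cV[C]_1) 0 j| <= eta.
    move=> j; have -> : const_mx (g.2 - h.2) = const_mx g.2 - const_mx h.2 :> 'cV[C]_1.
      by apply/matrixP => ? ?; rewrite !mxE.
    rewrite realifyB mxBE.
    by have := gh (rshift _ j); rewrite !row_mxEr => /ltW.
  by move=> /normc_le_realify/(_ 0); rewrite mxE.
have v_gh i : nc ((g.1 - h.1) i 0) <= eta *+ 2.
  apply: normc_le_realify => j.
  rewrite realifyB mxBE.
  by have := gh (lshift _ j); rewrite !row_mxEl => /ltW.
have Ugh : U (g * h^-1)%g.
  apply: eU => [i|]; last first.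
    apply: le_lt_trans t_gh (le_lt_trans _ etaK).
    rewrite ler_peMr ?mulrn_wge0 ?(ltW eta0)// lerDl.
    by rewrite sumr_ge0// => _ _; rewrite mulr_ge0// mulrn_wge0.
  rewrite fst_divg mxBE; apply: le_lt_trans (le_normcD _ _) _.
  apply: le_lt_trans etaK; rewrite mulrDr mulr1 lerD//.
  rewrite [X in X <= _]normcN mxE mulr_sumr.
  apply: le_trans (normc_sum _ _) _.
  apply: ler_sum => k _; rewrite [X in X <= _]normcM.
  rewrite mulrA ler_pM ?normc_ge0 ?hr//.
  have t1 := le_trans t_gh eta_half.
  by apply: le_trans (cP _ t1 i k) _; rewrite mulrC ler_wpM2r.
have /= gh1 : [set 1%g : G] (g * h^-1)%g.
  by rewrite -UD; split => //; apply: subgroupM => //; [exact: AD|];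
    by apply: subgroupV => //; exact: AD.
by rewrite -(mulgVK h g) gh1 mul1g.
Qed.

End DiscreteSubgroups.

Theorem theorem7p5 (R : realType) (d : nat) (J : 'M[cplx R]_d)
    (J_neq0 : J != 0) (J_jordan : jordan_normal_form J)
    (D : set (almost_abelian_group J))
    (D_subgroup : group_closed [in D])
    (D_discrete : discrete_subset D) :
  finitely_generated D.
Proof.
apply: (finitely_generated_discrete_cocycle D_subgroup _ (cocycle_almost_abelian D)).
- by move=> g h _ _; exact: time_coordsM.
- move=> g _ g0; rewrite /linear_part.
  have -> : g.2 = 0.
    apply: (@eq0_normc R); apply/eqP; rewrite eq_le normc_ge0 andbT.
    by rewrite -(mul0rn R 2); apply: nc_time => i j; rewrite g0 mxE normr0.
  by rewrite scale0r expmx0 [LHS]realify_mx1.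
- by move=> A AD; exact: discrete_bounded_finite D_subgroup D_discrete AD.
Qed.
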